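(* Let $(X,d)$ be a compact metric space and let $R_{\mathfrak X}=(X_j,f_j)_{1\le j\le n}$ be a contractive local IFS on $X$ with (non-empty) local attractor $A_{\mathfrak X}$. Then $A^\infty_{\mathfrak X}\ne\emptyset$. Furthermore, there exists $\widehat\Sigma_{\mathfrak X}\subset\Sigma^-_{\mathfrak X}\times\Sigma^+$ such that: (1) $\pi_{\mathfrak X}\circ\pi_{\Sigma^-}(\widehat\Sigma_{\mathfrak X})=A^\infty_{\mathfrak X}$, where $\pi_{\Sigma^-}(\underline b,\underline a)=\underline b$; (2) $\widehat\Sigma_{\mathfrak X}$ is invariant under the two-sided shift $\widehat\sigma$ (i.e. $\widehat\sigma$ maps $\widehat\Sigma_{\mathfrak X}$ into itself), where, writing $(\underline b,\underline a)$ as a two-sided sequence with the $0$-th position boxed, $\widehat\sigma(\dots,b_{-3},b_{-2},b_{-1},\boxed{a_0},a_1,a_2,\dots)=(\dots,b_{-2},b_{-1},a_0,\boxed{a_1},a_2,a_3,\dots)$; (3) for each $(\underline b,\underline a)\in\widehat\Sigma_{\mathfrak X}$ one has $\widehat\sigma(\underline b,\underline a)=(\underline b\ast a_0,\sigma(\underline a))=(\tau_{a_0}(\underline b),\sigma(\underline a))$.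
   Context: A local IFS on a compact metric space $(X,d)$ is a family $R_{\mathfrak X}=(X_j,f_j)_{1\le j\le n}$ with $n\ge 2$, where $X_1,\dots,X_n$ are closed subsets of $X$ and each $f_j:X_j\to X$ is continuous. It is contractive if for each $j$ there is $\lambda_j\in[0,1)$ with $d(f_j(x),f_j(y))\le\lambda_j d(x,y)$ for all $x,y\in X_j$. The local Hutchinson-Barnsley operator is $F_{\mathfrak X}(B)=\bigcup_{1\le j\le n}f_j(B\cap X_j)$ for $B\subseteq X$; $A_{\mathfrak X}$ denotes the largest (for inclusion) set $B\subseteq X$ with $F_{\mathfrak X}(B)=B$, and is called the local attractor when it is non-empty. $A^\infty_{\mathfrak X}$ is the set of points of $A_{\mathfrak X}$ admitting an infinite orbit: $x\in A^\infty_{\mathfrak X}$ iff $x\in A_{\mathfrak X}$ and there is a sequence $(a_j)_{j\ge0}$ in $\{1,\dots,n\}$ such that, with $x_0=x$ and $x_{j+1}=f_{a_j}(x_j)$, one has $x_j\in X_{a_j}$ for every $j\ge0$. $\Sigma^-=\{1,\dots,n\}^{-\mathbb N}$ is the set of sequences $\underline b=(\dots,b_{-2},b_{-1})$; $\Sigma^+=\{1,\dots,n\}^{\mathbb N_0}$ is the set of sequences $\underline a=(a_0,a_1,\dots)$, with shift $\sigma(a_0,a_1,a_2,\dots)=(a_1,a_2,\dots)$. The concatenation maps are $\tau_j(\underline b)=\underline b\ast j=(\dots,b_{-2},b_{-1},j)$. For $\underline b\in\Sigma^-$ and $k\ge1$, $V_{[\underline b]_k}=f_{b_{-1}}\circ\cdots\circ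 f_{b_{-k}}(X_{b_{-k}})$, where by convention $f_i(A):=f_i(A\cap X_i)$ for $A\subseteq X$. Put $\pi_{\mathfrak X}(\underline b)=\bigcap_{k\ge1}V_{[\underline b]_k}$, which for a contractive local IFS is empty or a singleton (identified with its point), and $\Sigma^-_{\mathfrak X}=\{\underline b\in\Sigma^-:\pi_{\mathfrak X}(\underline b)\neq\emptyset\}$. *)

(* Defs.v *)
From HB Require Import structures.
From mathcomp Require Export all_boot all_order all_algebra.
From mathcomp Require Export boolp classical_sets reals topology.

Set Implicit Arguments.
Unset Strict Implicit.
Unset Printing Implicit Defensive.

Import Order.TTheory GRing.Theory Num.Theory.

Local Open Scope classical_set_scope.
Local Open Scope ring_scope.

(* A partial map f_j : X_j -> X is represented by a total function. Its values
   outside X_j are irrelevant: continuity is for the subspace topology of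
   [ldom j], and images and orbits only constrain points of [ldom j]. *)
Record local_ifs (R : realType) (X : metricType R) (n : nat) := LocalIFS {
  ldom : 'I_n -> set X;
  lmap : 'I_n -> X -> X;
  local_ifs_size : (2 <= n)%N;
  ldom_closed : forall j, closed (ldom j);
  lmap_continuous : forall j, {within ldom j, continuous (lmap j)}
}.

Definition contractive (R : realType) (X : metricType R) (n : nat)
    (S : local_ifs X n) : Prop :=
  forall j, exists l : R, 0 <= l < 1 /\
    forall x y, ldom S j x -> ldom S j y ->
      mdist (lmap S j x) (lmap S j y) <= l * mdist x y.

(* The convention f_j(B) := f_j(B `&` X_j). *)
Definition limage (R : realType) (X : metricType R) (n : nat)
    (S : local_ifs X n) (j : 'I_n) (B : set X) : set X :=
  lmap S j @` (B `&` ldom S j).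

Definition hutchinson (R : realType) (X : metricType R) (n : nat)
    (S : local_ifs X n) (B : set X) : set X :=
  \bigcup_(j in [set: 'I_n]) limage S j B.

Definition largest_fixed_set (R : realType) (X : metricType R) (n : nat)
    (S : local_ifs X n) (A : set X) : Prop :=
  hutchinson S A = A /\ forall B, hutchinson S B = B -> B `<=` A.

Definition local_attractor (R : realType) (X : metricType R) (n : nat)
    (S : local_ifs X n) (A : set X) : Prop :=
  largest_fixed_set S A /\ A !=set0.

(* [b : past n] is the sequence (..., b_{-2}, b_{-1}), with [b k] = b_{-(k+1)};
   [a : future n] is the sequence (a_0, a_1, ...). *)
Definition past (n : nat) : Type := nat -> 'I_n.
Definition future (n : nat) : Type := nat -> 'I_n.

Fixpoint orbit_along (R : realType) (X : metricType R) (n : nat)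
    (S : local_ifs X n) (a : future n) (x : X) (k : nat) : X :=
  if k is k'.+1 then lmap S (a k') (orbit_along S a x k') else x.

(* The points of [A] admitting an infinite orbit. *)
Definition infinite_orbit_set (R : realType) (X : metricType R) (n : nat)
    (S : local_ifs X n) (A : set X) : set X :=
  [set x | A x /\ exists a : future n,
                    forall k, ldom S (a k) (orbit_along S a x k)].

(* V_{[b]_k} = f_{b_{-1}} (... (f_{b_{-k}} (X_{b_{-k}}))), for k >= 1. *)
Definition cylinder_image (R : realType) (X : metricType R) (n : nat)
    (S : local_ifs X n) (b : past n) (k : nat) : set X :=
  foldr (limage S) (ldom S (b k.-1)) (mkseq b k).

(* pi(b) as a set, empty or a singleton in the contractive case. *)
Definition code_map (R : realType) (X : metricType R) (n : nat)
    (S : local_ifs X n) (b : past n) : set X :=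
  \bigcap_(k in [set k | (1 <= k)%N]) cylinder_image S b k.

Definition admissible_past (R : realType) (X : metricType R) (n : nat)
    (S : local_ifs X n) : set (past n) :=
  [set b | code_map S b !=set0].

Definition sigma (n : nat) (a : future n) : future n := fun k => a k.+1.

Definition append (n : nat) (b : past n) (j : 'I_n) : past n :=
  fun k => if k is k'.+1 then b k' else j.

Definition tau (n : nat) (j : 'I_n) (b : past n) : past n := append b j.

(* Two-sided sequences: since [Negz k] is the integer -(k+1), the entry of
   [join_seq (b, a)] at -(k+1) is b_{-(k+1)} and its entry at k is a_k. *)
Definition join_seq (n : nat) (c : past n * future n) : int -> 'I_n :=
  fun z => match z with Posz k => c.2 k | Negz k => c.1 k end.

Definition split_seq (n : nat) (w : int -> 'I_n) : past n * future n :=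
  (fun k => w (Negz k), fun k => w (Posz k)).

Definition two_sided_shift (n : nat) (c : past n * future n) :
    past n * future n :=
  split_seq (fun z => join_seq c (z + 1)).

(* Main.v *)
Require Import Defs.
From mathcomp Require Import cardinality sequences normedtype.

(** A point of the attractor A has a preimage in A. So, stepping backwards inside
    A, one finds for every k a point from which some orbit makes k steps without
    leaving A. The set of such points is closed, because A is closed
    ([largest_fixed_set_closed]), and it decreases with k; compactness gives a
    point with orbits of every length, and Koenig's lemma ([survivors_step])
    turns them into an infinite orbit. Hence the set of points with an infinite
    orbit is not empty.

    For the symbolic part, take the pairs (b, a) such that b codes a point x of A
    and a is the itinerary of an infinite orbit of x. Every point of A has a
    code, namely the itinerary of a backward orbit in A ([postfixed_code]). A
    code determines its point ([code_map_singleton]), because two points of the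
    cylinder of rank k are at distance at most L ^ k * M, where L < 1 is a common
    contraction ratio and M bounds the distances in X. This gives the image of
    the pairs under the code map. The shift replaces x by its image under the map
    of index a_0; this image lies in A and is coded by b followed by a_0
    ([code_map_append]). *)

Set Implicit Arguments.
Unset Strict Implicit.
Unset Printing Implicit Defensive.

Import Order.TTheory GRing.Theory Num.Theory.
Import numFieldNormedType.Exports.

Local Open Scope classical_set_scope.
Local Open Scope ring_scope.

(** * Compactness *)

Lemma compact_seq_cluster (T : topologicalType) (u : nat -> T) :
  compact [set: T] ->
  exists p : T, forall U, nbhs p U ->
    forall N, exists2 k, (N <= k)%N & U (u k).
Proof.
move=> cT; have [|p [_ clp]] := cT (u @ \oo) _; first exact: filterT.
exists p => U nU N.
have uN : (u @ \oo) (u @` [set k | (N <= k)%N]).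
  by exists N => // k /= Nk; exists k.
by have [_ [[k Nk <-] Uk]] := clp _ _ uN nU; exists k.
Qed.

Lemma compact_nested_closed (T : topologicalType) (D : nat -> set T) :
  compact [set: T] -> (forall k, closed (D k)) -> (forall k, D k !=set0) ->
  (forall m k, (m <= k)%N -> D k `<=` D m) -> exists p, forall k, D k p.
Proof.
move=> cT cD D0 decD.
have [u uD] := choice D0.
have [p clp] := compact_seq_cluster u cT.
exists p => m; apply: cD => U nU; have [k mk Uk] := clp U nU m.
by exists (u k); split=> //; exact: decD mk _ (uD k).
Qed.

Lemma compact_mdist_bounded (R : realType) (X : metricType R) :
  compact [set: X] -> exists M : R, forall x y : X, mdist x y <= M.
Proof.
move=> cX; have [[x0 _]|noX] := pselect (exists x : X, True); last first.
  by exists 0 => x; case: noX; exists x.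
suff [M0 leM0] : exists M0 : R, forall y, mdist x0 y <= M0.
  exists (M0 + M0) => x y; apply: le_trans (metric_triangle x x0 y) _.
  by rewrite lerD// metric_sym.
apply: contrapT => unb.
have far (k : nat) : exists y, k%:R < mdist x0 y.
  apply: contrapT => near; apply: unb; exists k%:R => y.
  by rewrite leNgt; apply/negP => ky; apply: near; exists y.
have [u uP] := choice far.
have [p clp] := compact_seq_cluster u cX.
have [k Nk] := clp _ (nbhsx_ballx p 1 ltr01)
  (Num.bound (mdist x0 p + 1)).
rewrite ballEmdist /= => pk.
have := uP k; apply/negP; rewrite -leNgt.
apply: le_trans (metric_triangle x0 p (u k)) _.
apply: (@le_trans _ _ (mdist x0 p + 1)); first by rewrite lerD2l ltW.
apply: (@le_trans _ _ (Num.bound (mdist x0 p + 1))%:R); last by rewrite ler_nat.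
by apply: ltW; apply: archi_boundP; rewrite addr_ge0 ?mdist_ge0.
Qed.

(** * The local attractor *)

Section LocalIFS.
Context (R : realType) (X : metricType R) (n : nat) (S : local_ifs X n).

Let idx0 : 'I_n := Ordinal (ltnW (local_ifs_size S)).

Lemma hutchinsonS (B C : set X) :
  B `<=` C -> hutchinson S B `<=` hutchinson S C.
Proof.
move=> BC x [j _ [y [By yj] <-]]; exists j => //.
by exists y => //; split=> //; exact: BC.
Qed.

(** By Knaster-Tarski, the largest fixed set of the monotone operator
    [hutchinson S] also contains every set B with B included in its image. *)
Lemma postfixed_sub_largest (A B : set X) :
  largest_fixed_set S A -> B `<=` hutchinson S B -> B `<=` A.
Proof.
move=> [_ maxA] Bpost.
pose G := \bigcup_(C in [set C | C `<=` hutchinson S C]) C.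
have Gpost : G `<=` hutchinson S G.
  move=> x [C Cpost Cx]; apply: hutchinsonS (Cpost _ Cx) => y Cy.
  by exists C.
have GA : G `<=` A.
  apply: maxA; apply/seteqP; split=> // x Gx.
  by exists (hutchinson S G) => //; exact: hutchinsonS.
by move=> x Bx; apply: GA; exists B.
Qed.

Lemma hutchinson_closed (B : set X) :
  compact [set: X] -> closed B -> closed (hutchinson S B).
Proof.
move=> cX cB; apply: closed_bigcup => [|j _]; first exact: finite_finset.
apply: compact_closed; first exact: metric_hausdorff.
apply: continuous_compact.
  apply: continuous_subspaceW (@lmap_continuous _ _ _ S j).
  exact: subIsetr.
apply: subclosed_compact cX _ => //.
by apply: closedI => //; exact: ldom_closed.
Qed.

(** The image of the closure of A is closed and contains [hutchinson S A = A],
    so it contains the closure of A; maximality then puts the closure inside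
    A. *)
Lemma largest_fixed_set_closed (A : set X) :
  compact [set: X] -> largest_fixed_set S A -> closed A.
Proof.
move=> cX lA; rewrite closure_id; apply/seteqP; split.
  exact: subset_closure.
apply: (postfixed_sub_largest lA).
have /closure_id -> : closed (hutchinson S (closure A)).
  by apply: hutchinson_closed => //; exact: closed_closure.
apply: closureS; rewrite -{1}(lA.1).
by apply: hutchinsonS; exact: subset_closure.
Qed.

(** * Points with an infinite forward orbit *)

(** The points of A which some map of the system sends into B. *)
Definition step_into (A B : set X) : set X :=
  A `&` \bigcup_(j in [set: 'I_n]) (ldom S j `&` lmap S j @^-1` B).

Lemma step_intoS (A B C : set X) :
  B `<=` C -> step_into A B `<=` step_into A C.
Proof.
move=> BC x [Ax [j _ [jx Bx]]]; split=> //.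
by exists j => //; split=> //; exact: BC.
Qed.

Lemma step_into_closed (A B : set X) :
  closed A -> closed B -> closed (step_into A B).
Proof.
move=> cA cB; apply: closedI => //; apply: closed_bigcup => [|j _].
  exact: finite_finset.
rewrite closed_setSI; last exact: ldom_closed.
by move: cB; apply: (continuous_closedP _).1; exact: lmap_continuous.
Qed.

(** The points of A from which some orbit makes k steps without leaving A. *)
Definition survivors (A : set X) (k : nat) : set X := iter k (step_into A) A.

Lemma survivors_sub (A : set X) k : survivors A k `<=` A.
Proof. by case: k => [//|k] x []. Qed.

Lemma survivors_decr (A : set X) m k :
  (m <= k)%N -> survivors A k `<=` survivors A m.
Proof.
have decr1 i : survivors A i.+1 `<=` survivors A i.
  by elim: i => [|i IH]; [exact: survivors_sub | exact: step_intoS].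
move=> /subnK <-; elim: (k - m)%N => [//|i IH] x.
by rewrite addSn => /decr1; exact: IH.
Qed.

Lemma survivors_closed (A : set X) k : closed A -> closed (survivors A k).
Proof. by move=> cA; elim: k => [//|k IH]; exact: step_into_closed. Qed.

(** A point with k steps ahead of it has a preimage in A, which has k + 1. *)
Lemma survivors_nonempty (A : set X) k :
  A `<=` hutchinson S A -> A !=set0 -> survivors A k !=set0.
Proof.
move=> Apost A0; elim: k => [//|k [x kx]].
have [j _ [y [Ay jy] yx]] := Apost _ (survivors_sub kx).
by exists y; split=> //; exists j => //; split=> //=; rewrite yx.
Qed.

(** Koenig's lemma: since there are finitely many maps, a point with orbits of
    every length is sent by one of them to another such point. *)
Lemma survivors_step (A : set X) (x : X) : (forall k, survivors A k x) ->
  exists j, ldom S j x /\ forall k, survivors A k (lmap S j x).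
Proof.
move=> sx; apply: contrapT => stuck.
have dead j : exists k, ~ (ldom S j x /\ survivors A k (lmap S j x)).
  apply: contrapT => alive; apply: stuck; exists j.
  have alivej k : ldom S j x /\ survivors A k (lmap S j x).
    by apply: contrapT => h; apply: alive; exists k.
  by split=> [|k]; [exact: (alivej 0%N).1 | exact: (alivej k).2].
have [u uP] := fin_all_exists dead.
(* at depth [\max_i u i] every map has failed *)
have [_ [j _ [jx sj]]] := sx (\max_i u i).+1.
apply: (uP j); split=> //.
exact: survivors_decr (leq_bigmax j) _ sj.
Qed.

(** The itinerary is built by always following a map given by
    [survivors_step]. *)
Lemma survivors_infinite_orbit (A : set X) (x : X) :
  (forall k, survivors A k x) -> infinite_orbit_set S A x.
Proof.
move=> sx; split; first exact: (sx 0%N).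
have next y : exists j, (forall k, survivors A k y) ->
    ldom S j y /\ forall k, survivors A k (lmap S j y).
  have [sy|nsy] := pselect (forall k, survivors A k y); last by exists idx0.
  by have [j jP] := survivors_step sy; exists j.
have [g gP] := choice next.
pose a : future n := fun k => g (iter k (fun y => lmap S (g y) y) x).
have aE k : orbit_along S a x k = iter k (fun y => lmap S (g y) y) x.
  by elim: k => //= k ->.
have sa k : forall m, survivors A m (orbit_along S a x k).
  elim: k => [//|k IH]; have [_] := gP _ IH.
  by rewrite /= /a -aE.
by exists a => k; have [+ _] := gP _ (sa k); rewrite /a -aE.
Qed.

Lemma infinite_orbit_set_nonempty (A : set X) :
  compact [set: X] -> local_attractor S A -> infinite_orbit_set S A !=set0.
Proof.
move=> cX [lA A0].
have [|||x xP] := @compact_nested_closed _ (survivors A) cX.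
- by move=> k; apply: survivors_closed; exact: largest_fixed_set_closed.
- by move=> k; apply: survivors_nonempty => //; rewrite lA.1.
- exact: survivors_decr.
by exists x; exact: survivors_infinite_orbit.
Qed.

(** * The code map *)

(** When A is included in its image, choosing preimages in A again and again
    gives a point x of A an infinite backward orbit y 0 = x, y 1, y 2, ...; its
    itinerary b is a code of x. *)
Lemma postfixed_code (A : set X) (x : X) :
  A `<=` hutchinson S A -> A x -> exists b, code_map S b x.
Proof.
move=> Apost Ax.
have pre y : exists p : 'I_n * X, A y ->
    [/\ A p.2, ldom S p.1 p.2 & lmap S p.1 p.2 = y].
  have [Ay|nAy] := pselect (A y); last by exists (idx0, y).
  by have [j _ [z [Az jz] zy]] := Apost _ Ay; exists (j, z).
have [h hP] := choice pre.
pose y k := iter k (fun z => (h z).2) x.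
pose b : past n := fun k => (h (y k)).1.
have Ay k : A (y k) by elim: k => [//|k IH]; have [] := hP _ IH.
exists b => -[//|k] _; rewrite /cylinder_image mkseqS foldr_rcons /=.
(* the innermost set of the cylinder is [ldom S (b k)], which contains
   [y k.+1] *)
have : limage S (b k) (ldom S (b k)) (y k).
  by have [_ dom yk] := hP _ (Ay k); exists (y k.+1).
elim: k (limage _ _ _) => [//|k IH] B By.
rewrite mkseqS foldr_rcons; apply: IH.
by have [_ dom yk] := hP _ (Ay k); exists (y k.+1).
Qed.

(** The largest of the finitely many contraction ratios works for all maps. *)
Lemma contractive_uniform : contractive S ->
  exists2 L : R, 0 <= L < 1 & forall j x y, ldom S j x -> ldom S j y ->
    mdist (lmap S j x) (lmap S j y) <= L * mdist x y.
Proof.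
move=> ctr; have [l lP] := fin_all_exists ctr.
exists (\big[Num.max/0]_j l j).
  rewrite bigmax_ge_id /=; apply: bigmax_lt => // j _.
  by have [/andP[]] := lP j.
move=> j x y xj yj; have [_ lj] := lP j.
apply: le_trans (lj x y xj yj) _.
by rewrite ler_wpM2r ?mdist_ge0// le_bigmax.
Qed.

Lemma foldr_limage_mdist (L M : R) (w : seq 'I_n) (B : set X) :
  0 <= L ->
  (forall j x y, ldom S j x -> ldom S j y ->
    mdist (lmap S j x) (lmap S j y) <= L * mdist x y) ->
  (forall x y, B x -> B y -> mdist x y <= M) ->
  forall x y, foldr (limage S) B w x -> foldr (limage S) B w y ->
    mdist x y <= L ^+ size w * M.
Proof.
move=> L0 Lip BM; elim: w => [|j w IH] x y /=.
  by rewrite expr0 mul1r; exact: BM.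
move=> [x' [wx jx] <-] [y' [wy jy] <-]; apply: le_trans (Lip _ _ _ jx jy) _.
by rewrite exprS -mulrA ler_wpM2l// IH.
Qed.

Lemma code_map_singleton (b : past n) (x : X) :
  compact [set: X] -> contractive S -> code_map S b x ->
  code_map S b = [set x].
Proof.
move=> cX ctr bx; apply/seteqP; split=> [y by_|_ -> //].
have [L /andP[L0 L1] Lip] := contractive_uniform ctr.
have [M leM] := compact_mdist_bounded cX.
apply: mdist_positivity; apply/eqP; rewrite eq_le mdist_ge0 andbT.
have small k : mdist y x <= geometric (L * M) L k.
  rewrite /= mulrAC -exprS -[X in L ^+ X](size_mkseq b).
  exact: (foldr_limage_mdist L0 Lip (fun u v _ _ => leM u v)
    (by_ k.+1 isT) (bx k.+1 isT)).
have lim0 : geometric (L * M) L @ \oo --> 0.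
  by apply: cvg_geometric; rewrite ger0_norm.
by apply: (cvgr_to_ge lim0); exact: nearW.
Qed.

(** If b codes x, then b followed by j codes the image of x under the j-th
    map. *)
Lemma code_map_append (b : past n) (j : 'I_n) (x : X) :
  code_map S b x -> ldom S j x -> code_map S (append b j) (lmap S j x).
Proof.
move=> bx jx [//|k] _.
have -> : cylinder_image S (append b j) k.+1 =
    limage S j (foldr (limage S) (ldom S (append b j k)) (mkseq b k)).
  by rewrite /cylinder_image /mkseq /= -[1%N]addn0 iotaDl -map_comp.
exists x => //; split=> //.
by case: k => [//|k]; exact: (bx k.+1 isT).
Qed.

Lemma orbit_along_sigma (a : future n) (x : X) (k : nat) :
  orbit_along S (sigma a) (lmap S (a 0%N) x) k = orbit_along S a x k.+1.
Proof. by elim: k => //= k ->. Qed.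

End LocalIFS.

Lemma two_sided_shiftE n (b : past n) (a : future n) :
  two_sided_shift (b, a) = (append b (a 0%N), sigma a).
Proof.
congr pair; apply/funext => -[|k] //=.
  by rewrite subn1.
by rewrite /sigma addn1.
Qed.

Local Close Scope ring_scope.

Theorem theorem3 (R : realType) (X : metricType R) (n : nat)
    (S : local_ifs X n) (A : set X) :
  compact [set: X] ->
  contractive S ->
  local_attractor S A ->
  infinite_orbit_set S A !=set0 /\
  exists Shat : set (past n * future n),
    [/\ Shat `<=` admissible_past S `*` [set: future n],
        (* a point x is identified with the singleton [set x] *)
        [set code_map S c.1 | c in Shat] =
          [set [set x] | x in infinite_orbit_set S A],
        [set two_sided_shift c | c in Shat] `<=` Shat &
        forall (b : past n) (a : future n), Shat (b, a) ->
          two_sided_shift (b, a) = (append b (a 0%N), sigma a) /\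
          two_sided_shift (b, a) = (tau (a 0%N) b, sigma a)].
Proof.
move=> cX ctr attA; split; first exact: infinite_orbit_set_nonempty.
have [[fixA _] _] := attA.
exists [set c | exists x, [/\ A x, code_map S c.1 x &
  forall k, ldom S (c.2 k) (orbit_along S c.2 x k)]]; split.
- by move=> [b a] [x [_ bx _]]; split=> //; exists x.
- apply/seteqP; split=> [_ [[b a] [x [Ax bx ax]] <-]|_ [x [Ax [a ax]] <-]].
    exists x; last by rewrite (code_map_singleton cX ctr bx).
    by split=> //; exists a.
  have [|b bx] := @postfixed_code _ _ _ S A x _ Ax; first by rewrite fixA.
  by exists (b, a); [exists x | exact: code_map_singleton].
- move=> _ [[b a] [x [Ax bx ax]] <-]; rewrite two_sided_shiftE.
  exists (lmap S (a 0%N) x); split=> /=.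
  + by rewrite -fixA; exists (a 0%N) => //; exists x.
  + by apply: code_map_append => //; exact: ax 0%N.
  + by move=> k; rewrite orbit_along_sigma; exact: ax k.+1.
- by move=> b a _; rewrite two_sided_shiftE.
Qed.
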